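(* Let $R_n^* := T(\eta_n^*, \mathbb{P}_n^* ) - T(\eta_n, \hat{P}_n) - (\mathbb{P}_n^* - \hat{P}_n)\phi_n^*$. Suppose that: (B1) there exists a class $\mathcal{F}$ of measurable functions from $(\mathcal{X},\mathcal{B})$ to $\mathbb{R}$ such that (a) $\phi_0 \in \mathcal{F}$ and $P_W^*(\phi_n^* \in \mathcal{F}) \to 1$ in $P_0^*$-outer probability, and (b) $\mathbb{G}_n^*$ converges weakly to $\mathbb{G}_0$ in $\ell^\infty(\mathcal{F})$ conditionally on $X_1,\dots,X_n$ in outer probability, where $\mathbb{G}_0$ is the $P_0$-Brownian bridge process; (B2) $\|\phi_n^* - \phi_0\|_{L_2(P_0)} = o_{P_W^*}(1)$; (B3) $R_n^* = o_{P_W^*}(n^{-1/2})$. Then $$T(\eta_n^*, \mathbb{P}_n^* ) = T(\eta_n, \hat{P}_n) + (\mathbb{P}_n^* - \hat{P}_n)\phi_0 + o_{P_W^*}(n^{-1/2}),$$ and consequently $n^{1/2}\left[T(\eta_n^*, \mathbb{P}_n^* ) - T(\eta_n,\hat{P}_n)\right]$ converges weakly to $\mathbb{G}_0\phi_0$ conditionally on $X_1,\dots,X_n$ in outer probability.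
   Context: Data and estimator. $X_1,\dots,X_n \in \mathcal{X}\subseteq\mathbb{R}^d$ are IID from a probability measure $P_0$ on $(\mathcal{X},\mathcal{B})$ lying in a statistical model $\mathcal{M}$; $\mathbb{P}_n$ is the empirical distribution; $Pf := \int f\,dP$. $\psi:\mathcal{M}\to\mathbb{R}$ is the target parameter, $\psi_0=\psi(P_0)$, and $\phi_0:\mathcal{X}\to\mathbb{R}$ is an influence function, with $P_0\phi_0=0$ and $P_0\phi_0^2<\infty$. $\eta:\mathcal{M}\to\mathcal{H}$ is a nuisance parameter, $\eta_0=\eta(P_0)$, and $\eta_n\in\mathcal{H}$ is an estimator of $\eta_0$ based on $X_1,\dots,X_n$. $T:\mathcal{H}\times\mathcal{M}^+\to\mathbb{R}$, where $\mathcal{M}^+$ is the union of $\mathcal{M}$ and the finite discrete probability measures on $(\mathcal{X},\mathcal{B})$, is such that $\psi_0=T(\eta_0,P_0)$, and the estimator is $\psi_n=T(\eta_n,\mathbb{P}_n)$. Bootstrap. $W_{n1},\dots,W_{nn}$ are IID with law $Q_n$ on a measurable space $(\mathcal{W}_n,\mathcal{C}_n)$, independent of the data, and $X_i^*=\gamma_n(X_1,\dots,X_n,W_{ni})$ for a fixed measurable $\gamma_n$. $\hat{P}_n$ (the bootstrap sampling distribution, an estimate of $P_0$) is the conditional law of $X_i^*$ given the data, so $X_1^*,\dots,X_n^*$ are conditionally IID from $\hat{P}_n$. $\mathbb{P}_n^*$ is the empirical distribution of $X_1^*,\dots,X_n^*$ and $\mathbb{G}_n^* := n^{1/2}(\mathbb{P}_n^*-\hat{P}_n)$.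 $\eta_n^*\in\mathcal{H}$ is any estimator of $\eta_0$ based on the bootstrap data and original data, $\psi_n^*=T(\eta_n^*,\mathbb{P}_n^* )$, and $T(\eta_n,\hat P_n)$ is assumed well-defined. $\phi_n^*:\mathcal{X}\to\mathbb{R}$ is an estimator of $\phi_0$ that may depend on the bootstrap and original data. Modes of convergence. $P_0^*,E_0^*$ are outer probability and expectation. The conditional outer expectation $E_W^*h$ of a map $h$ of $(X_1,\dots,X_n,W_{n1},\dots,W_{nn})$ is the infimum of $\int U(X_1,\dots,X_n,w)\,dQ_n^n(w)$ over $U\ge h$ that are measurable in $w$ with existing integral; $P_W^*(A)=E_W^*1_A$. $Y_n=o_{P_W^*}(1)$ means that for every $\varepsilon>0$, $P_W^*(|Y_n|\ge\varepsilon)\to0$ in $P_0^*$-outer probability; $Y_n=o_{P_W^*}(r_n)$ means $Y_n/r_n=o_{P_W^*}(1)$. For a metric space $\mathbb{D}$, $BL_1(\mathbb{D})$ is the set of 1-Lipschitz $h:\mathbb{D}\to[-1,1]$; $G_n$ converges weakly to a tight Borel measurable $G$ in $\mathbb{D}$ conditionally on the data in outer probability if $\sup_{h\in BL_1(\mathbb{D})}|E_W^*h(G_n)-E_0h(G)|\to0$ in $P_0^*$-outer probability. $\ell^\infty(\mathcal{F})$ is the space of bounded real functions on $\mathcal{F}$ with the supremum norm. The $P_0$-Brownian bridge $\mathbb{G}_0$ is the tight mean-zero Gaussian process with covariance $P_0(fg)-P_0f\,P_0g$.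
   Formalization: In (B1)(a), the condition that φ_n^* lies in F with conditional probability tending to 1 is taken with inner instead of outer conditional probability; with outer probability the claim fails for non-measurable events, and the two agree when the event is measurable. *)

(* Defs.v *)
From HB Require Import structures.
From mathcomp Require Import all_boot all_order all_algebra.
From mathcomp Require Import all_classical all_reals all_analysis.
From mathcomp Require Import measurable_realfun.

Set Implicit Arguments.
Unset Strict Implicit.
Unset Printing Implicit Defensive.

Import Order.TTheory GRing.Theory Num.Theory.
Import numFieldNormedType.Exports.

Local Open Scope classical_set_scope.
Local Open Scope ring_scope.

(* Samples of size [n.+1] are tuples, so that the empirical distribution is
   always a probability measure; every [n : nat] below stands for the sample
   size [n.+1], and [n --> \oo] is the usual large-sample limit. *)

Section iid_law.
Context {R : realType} (d : measure_display) (T : measurableType d).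

Definition cons_pair n (p : T * n.-tuple T) : n.+1.-tuple T :=
  [the n.+1.-tuple T of p.1 :: p.2].

Lemma measurable_cons_pair n : measurable_fun setT (@cons_pair n).
Proof. by apply: measurable_cons; [exact: measurable_fst|exact: measurable_snd]. Qed.

HB.instance Definition _ n :=
  isMeasurableFun.Build _ _ _ _ (@cons_pair n) (@measurable_cons_pair n).

(* The [n]-fold product [P^n], the joint law of [n] IID draws from [P]. *)
Fixpoint iid_law (P : probability T R) (n : nat) : probability (n.-tuple T) R :=
  match n with
  | 0 => dirac [tuple]
  | m.+1 => distribution (P \x iid_law P m)%E (@cons_pair m)
  end.

Lemma iid_law_box (P : probability T R) n (A : 'I_n -> set T) :
  (forall i, measurable (A i)) ->
  iid_law P n [set t | forall i, A i (tnth t i)] = (\prod_(i < n) P (A i))%E.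
Proof.
elim: n A => [|n IH] A mA /=.
  rewrite big_ord0 /dirac indicE mem_set//; by case.
rewrite big_ord_recl /distribution /pushforward -IH => [|i]; last exact: mA.
have mB : measurable [set t : n.-tuple T | forall i, A (lift ord0 i) (tnth t i)].
  rewrite (_ : [set t | _] = \bigcap_(i in [set: 'I_n])
      ((fun t : n.-tuple T => tnth t i) @^-1` A (lift ord0 i))); last first.
    by apply/seteqP; split=> t h i => [_|]; exact: (h i).
  apply: fin_bigcap_measurable => // i _.
  rewrite -[X in measurable X]setTI.
  exact: (@measurable_tnth _ _ n i).
rewrite -product_measure1E//; congr (_ _).
apply/seteqP; split=> -[x t] /=.
  move=> h; split; first by have := h ord0; rewrite tnth0.
  by move=> i; have := h (lift ord0 i); rewrite tnthS.
move=> [hx ht] i; have [->|[j ->]] : i = ord0 \/ exists j, i = lift ord0 j.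
- by case: (unliftP ord0 i) => [j ->|->]; [right; exists j|left].
- by rewrite tnth0.
- by rewrite tnthS.
Qed.

End iid_law.

Section empirical.
Context {R : realType} (d : measure_display) (T : measurableType d) (n : nat).
Variable x : n.+1.-tuple T.

Definition empirical : set T -> \bar R :=
  mscale (n.+1%:R^-1)%:nng (msum (fun i => \d_(nth point x i)) n.+1).

HB.instance Definition _ := Measure.on empirical.

Let empirical_setT : empirical setT = 1%E.
Proof.
rewrite /empirical /mscale/= /msum.
rewrite (eq_bigr (fun=> 1%E)) => [|i _]; last exact: diracT.
by rewrite sumEFin sumr_const card_ord -EFinM mulVf// pnatr_eq0.
Qed.

HB.instance Definition _ :=
  Measure_isProbability.Build _ _ _ empirical empirical_setT.

End empirical.

Section outer.
Context {R : realType} (d : measure_display) (T : measurableType d).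
Local Open Scope ereal_scope.

(* The majorants [U] range over measurable functions whose integral exists. *)
Definition outer_expectation (P : probability T R) (h : T -> \bar R) : \bar R :=
  ereal_inf [set \int[P]_t U t | U in [set U : T -> \bar R |
    [/\ measurable_fun setT U,
        \int[P]_t U^\+ t < +oo \/ \int[P]_t U^\- t < +oo &
        forall t, h t <= U t]]].

Definition outer_prob (P : probability T R) (A : set T) : \bar R :=
  outer_expectation P (EFin \o \1_A).

Definition inner_prob (P : probability T R) (A : set T) : \bar R :=
  1 - outer_prob P (~` A).

End outer.

Section cvg_outer.
Context {R : realType} (d : measure_display) (T : measurableType d).
Local Open Scope ereal_scope.

(* For [n : nat], [Z n] is a function of the data [X_1, ..., X_(n.+1)], drawn
   from the product law, and need not be measurable. *)
Definition cvg_outer_prob (P0 : probability T R)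
    (Z : forall n, n.+1.-tuple T -> \bar R) (c : R) : Prop :=
  forall eps : R, (0 < eps)%R ->
    outer_prob (iid_law P0 n.+1) [set x | eps%:E <= `|Z n x - c%:E|]
      @[n --> \oo] --> 0.

End cvg_outer.

Section weak_limits.
Context {R : realType}.

Definition BL1 (D : metricType R) : set (D -> R) :=
  [set h | (forall x, `|h x| <= 1) /\
           (forall x y, `|h x - h y| <= mdist x y)].

Definition borel_measurable (d : measure_display) (O : measurableType d)
    (D : metricType R) (G : O -> D) : Prop :=
  forall U : set D, open U -> measurable (G @^-1` U).

Definition tight (d : measure_display) (O : measurableType d)
    (P : probability O R) (D : metricType R) (G : O -> D) : Prop :=
  forall eps : R, 0 < eps ->
    exists K : set D, compact K /\ (P (G @^-1` ~` K) <= eps%:E)%E.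

End weak_limits.

Section linf.
Context {R : realType}.

Record linf (T : Type) := Linf {
  linf_fun :> T -> R ;
  linf_bounded : exists M : R, forall t, `|linf_fun t| <= M }.

Section linf_metric.
Context (T : Type).
Implicit Types f g h : linf T.

HB.instance Definition _ := gen_eqMixin (linf T).
HB.instance Definition _ := gen_choiceMixin (linf T).

Definition linf_dist f g : R := sup [set `|f t - g t| | t in setT].

Let dist_ubound f g : has_ubound [set `|f t - g t| | t in setT].
Proof.
have [M fM] := linf_bounded f; have [N gN] := linf_bounded g.
exists (M + N) => _ [t _ <-].
by rewrite (le_trans (ler_normB _ _))// lerD.
Qed.

Lemma linf_dist_ge f g t : `|f t - g t| <= linf_dist f g.
Proof. by apply: ub_le_sup => //; exists t. Qed.

Lemma linf_dist_le f g (c : R) : 0 <= c ->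
  (forall t, `|f t - g t| <= c) -> linf_dist f g <= c.
Proof.
move=> c0 fgc; have [[t]|nT] := pselect (inhabited T).
  by apply: ge_sup => [|_ [u _ <-] //]; exists `|f t - g t|, t.
rewrite /linf_dist (_ : [set _ | _ in _] = set0) ?sup0//.
by apply/seteqP; split=> [r [t _ _]|] //; case: nT; constructor.
Qed.

Let dist_ge0 f g : 0 <= linf_dist f g.
Proof.
have [[t]|nT] := pselect (inhabited T).
  exact: le_trans (linf_dist_ge f g t).
rewrite /linf_dist (_ : [set _ | _ in _] = set0) ?sup0//.
by apply/seteqP; split=> [r [t _ _]|] //; case: nT; constructor.
Qed.

Let distxx f : linf_dist f f = 0.
Proof.
by apply/eqP; rewrite eq_le dist_ge0 andbT linf_dist_le// => t; rewrite subrr normr0.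
Qed.

Let dist_positivity f g : linf_dist f g = 0 -> f = g.
Proof.
move=> fg0; have fg : linf_fun f = linf_fun g.
  apply/funext => t; apply/eqP; rewrite -subr_eq0 -normr_le0 -fg0.
  exact: linf_dist_ge.
case: f g fg {fg0} => [f bf] [g bg] /= fg; rewrite fg in bf *.
by rewrite (Prop_irrelevance bf bg).
Qed.

Let dist_sym f g : linf_dist f g = linf_dist g f.
Proof.
by rewrite /linf_dist; congr sup; apply/eq_imagel => t _; rewrite distrC.
Qed.

Let dist_triangle g f h : linf_dist f h <= linf_dist f g + linf_dist g h.
Proof.
apply: linf_dist_le => [|t]; first by rewrite addr_ge0.
by rewrite (le_trans (ler_distD (g t) _ _))// lerD// linf_dist_ge.
Qed.

HB.instance Definition _ := isMetric.Build R (linf T)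
  distxx dist_positivity dist_sym dist_triangle.

End linf_metric.
End linf.

(* [P f], with the [Rintegral] convention on functions that are not integrable. *)
Definition pint {R : realType} (d : measure_display) (T : measurableType d)
  (P : probability T R) (f : T -> R) : R := \int[P]_t f t.

Section gaussian.
Context {R : realType} (d : measure_display) (O : measurableType d).
Variable P : probability O R.

(* [normal_prob m 0] is a junk value in the library. *)
Definition normal_law (m s : R) : set R -> \bar R :=
  if s == 0 then \d_m else normal_prob m s.

Definition gaussian_rv (Z : O -> R) : Prop :=
  measurable_fun setT Z /\
  exists m s : R, forall A : set R, measurable A ->
    P (Z @^-1` A) = normal_law m s A.

Definition gaussian_process (I : Type) (G : O -> I -> R) : Prop :=
  forall (k : nat) (c : 'I_k -> R) (f : 'I_k -> I),
    gaussian_rv (fun o => \sum_(i < k) c i * G o (f i)).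

End gaussian.

(* The covariance presupposes [F `<=` L_2(P0)]; Borel measurability is with
   respect to the supremum distance on [linf F]. *)
Definition brownian_bridge {R : realType} (d d' : measure_display)
    (X : measurableType d) (P0 : probability X R) (F : set (X -> R))
    (O : measurableType d') (P : probability O R) (G : O -> linf (R := R) F)
    : Prop :=
  [/\ borel_measurable G,
      tight P G,
      gaussian_process P (fun o => linf_fun (G o)),
      (forall f, F f -> (\int[P0]_z ((f z) ^+ 2)%:E < +oo)%E) &
      (forall f g : F,
         ('E_P[fun o => G o f] = 0)%E /\
         covariance P (fun o => G o f) (fun o => G o g) =
           (pint P0 (fun z => set_val f z * set_val g z)
              - pint P0 (set_val f) * pint P0 (set_val g))%:E)].

Section bootstrap_sample.
Context {R : realType} (dX dW : measure_display).
Context (X : measurableType dX) (W : measurableType dW) (n : nat).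
Variables (Q : probability W R) (gamma : {mfun (n.+1.-tuple X * W)%type >-> X}).
Variable x : n.+1.-tuple X.

Definition boot_draw (w : W) : X := gamma (x, w).

Lemma measurable_boot_draw : measurable_fun setT boot_draw.
Proof. exact: measurable_fun_pair2. Qed.

HB.instance Definition _ :=
  isMeasurableFun.Build _ _ _ _ boot_draw measurable_boot_draw.

Definition boot_law : probability X R := distribution Q boot_draw.

Definition boot_sample (w : n.+1.-tuple W) : n.+1.-tuple X :=
  [tuple boot_draw (tnth w i) | i < n.+1].

Definition boot_diff (w : n.+1.-tuple W) (f : X -> R) : R :=
  pint (empirical (boot_sample w)) f - pint boot_law f.

End bootstrap_sample.

Section conditional_modes.
Context {R : realType} (dX : measure_display) (X : measurableType dX).
Context (dW : nat -> measure_display) (W : forall n, measurableType (dW n)).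
Variables (P0 : probability X R) (Q : forall n, probability (W n) R).

(* [P_W^*] and [E_W^*] are the outer probability and expectation under [Q_n^n],
   with the data [x] held fixed. *)
Definition oPW (r : nat -> R)
    (Y : forall n, n.+1.-tuple X -> n.+1.-tuple (W n) -> \bar R) : Prop :=
  forall eps : R, 0 < eps ->
    cvg_outer_prob P0 (fun n x => outer_prob (iid_law (Q n) n.+1)
      [set w | (eps%:E <= `|Y n x w * ((r n)^-1)%:E|)%E]) 0.

Definition cond_weak_cvg (D : metricType R)
    (G : forall n, n.+1.-tuple X -> n.+1.-tuple (W n) -> D)
    (dO : measure_display) (O : measurableType dO) (P : probability O R)
    (G0 : O -> D) : Prop :=
  [/\ borel_measurable G0,
      tight P G0 &
      cvg_outer_prob P0 (fun n x => ereal_sup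
        [set `|outer_expectation (iid_law (Q n) n.+1)
                 (fun w => (h (G n x w))%:E)
               - \int[P]_o (h (G0 o))%:E|%E | h in BL1 (D := D)]) 0].

End conditional_modes.

(* Main.v *)
Require Import Defs.
From HB Require Import structures.
From mathcomp Require Import all_boot all_order all_algebra.
From mathcomp Require Import all_classical all_reals all_analysis.
From mathcomp Require Import measurable_realfun.
From mathcomp Require finmap.
From mathcomp Require Import ring lra.

Set Implicit Arguments.
Unset Strict Implicit.
Unset Printing Implicit Defensive.

Import Order.TTheory GRing.Theory Num.Theory.
Import numFieldNormedType.Exports.

Local Open Scope classical_set_scope.
Local Open Scope ring_scope.

(** Write [G_n* f] for [n^(1/2) (P_n* - hat P_n) f].  Multiplied by [n^(1/2)],
    the error of the linearization at [phi0] is the remainder, multiplied by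
    [n^(1/2)], plus the increment [G_n* phi_n* - G_n* phi0], so what has to be
    shown is that replacing the estimated influence function by the true one
    costs nothing to first order.

    The increment is controlled by the Brownian bridge.  On the event that
    [phi_n*] lies in [F] within [L_2(P0)] distance [delta] of [phi0], it is at
    most the oscillation of [G_n*] over the [delta]-ball around [phi0].  For
    a fixed [delta], that oscillation, halved and truncated at 1, is a bounded
    Lipschitz functional on the space of bounded functions on [F], so weak
    convergence carries its expectation to the one under the bridge
    ([cond_weak_cvg_small]).  The limit is made small by the choice of [delta]
    ([bridge_continuous]); the choice comes before [n] grows, and depends on
    both the size and the probability aimed at.

    That the oscillation of the bridge is small in expectation follows from
    tightness and continuity in probability at [phi0] ([tight_osc]).  A compact
    set of bounded functions is, up to [eps], a finite set of functions, and
    finitely many bounded functions split the index set into finitely many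
    cells on each of which all of them are nearly constant.  By tightness the
    process is then nearly constant on each cell with high probability, so it
    suffices to compare it with its value at [phi0] at one index of the ball per
    cell.  There are finitely many such comparisons, and each holds with high probability
    by Chebyshev's inequality, as the variance of an increment of the bridge is
    at most the squared [L_2(P0)] distance of the indices ([bridge_increment]).

    The weak convergence statement is Slutsky's lemma for the evaluation at
    [phi0] ([cond_weak_cvg_slutsky]).  The bootstrap quantities may fail to be
    measurable; outer expectations of bounded maps are handled through bounded
    measurable majorants ([bounded_majorant]). *)

(** * Outer expectations of bounded maps *)

Section outer_expectation_bounded.
Context {R : realType} (d : measure_display) (T : measurableType d).
Variable P : probability T R.
Local Open Scope ereal_scope.

(** Comparing positive and negative parts separately also covers the majorants
    in the definition of the outer expectation whose integral is [+oo]. *)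
Lemma le_integral_measurable (f g : T -> \bar R) :
  measurable_fun setT f -> measurable_fun setT g ->
  (forall t, f t <= g t) -> \int[P]_t f t <= \int[P]_t g t.
Proof.
move=> mf mg fg; rewrite integralE [leRHS]integralE; apply: leeB.
  apply: ge0_le_integral => //; [exact: measurable_funepos|exact: measurable_funepos|].
  by move=> t _; apply: funepos_le; rewrite ?inE.
apply: ge0_le_integral => //; [exact: measurable_funeneg|exact: measurable_funeneg|].
by move=> t _; apply: funeneg_le; rewrite ?inE.
Qed.

Lemma integrable_bounded (V : T -> R) (M : R) :
  measurable_fun setT V -> (forall t, `|V t| <= M)%R ->
  P.-integrable setT (EFin \o V).
Proof.
move=> mV VM; apply: measurable_bounded_integrable => //.
  by rewrite (le_lt_trans (probability_le1 P measurableT))// ltry.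
by exists M; split=> [|m Mm t _ /=]; [exact: num_real|exact: le_trans (VM t) (ltW Mm)].
Qed.

Lemma integral_cst_probability (c : R) : \int[P]_t c%:E = c%:E.
Proof. by rewrite integral_cst// [X in _ * X]probability_setT mule1. Qed.

Lemma outer_expectation_le (h V : T -> R) (M : R) :
  measurable_fun setT V -> (forall t, `|V t| <= M)%R ->
  (forall t, h t <= V t)%R ->
  outer_expectation P (EFin \o h) <= \int[P]_t (V t)%:E.
Proof.
move=> mV VM hV; apply: ereal_inf_lbound; exists (EFin \o V) => //.
split; first exact/measurable_EFinP.
  have fV := integrable_bounded mV VM.
  by left; exact: integral_funepos_lt_pinfty fV.
by move=> t; rewrite lee_fin.
Qed.

(** Truncating a majorant at the bound of [h] keeps it a majorant and lowers
    its integral, so the majorants of a bounded map can be taken real-valued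
    and bounded; this makes all integrals below additive. *)
Lemma bounded_majorant (h : T -> R) (M : R) (U : T -> \bar R) :
  (forall t, `|h t| <= M)%R -> measurable_fun setT U ->
  (forall t, (h t)%:E <= U t) ->
  exists V : T -> R, [/\ measurable_fun setT V, (forall t, `|V t| <= M)%R,
    (forall t, h t <= V t)%R & \int[P]_t (V t)%:E <= \int[P]_t U t].
Proof.
move=> hM mU hU.
have Mh t : - M%:E <= (h t)%:E.
  by rewrite -EFinN lee_fin lerNl (le_trans (ler_norm _))// normrN.
have hV t : (h t)%:E <= mine (U t) M%:E.
  by rewrite le_min hU lee_fin (le_trans (ler_norm _)).
have VM t : mine (U t) M%:E <= M%:E by rewrite ge_min lexx orbT.
have Vfin t : mine (U t) M%:E \is a fin_num.
  by rewrite fin_numElt (lt_le_trans _ (hV t)) ?ltNyr// (le_lt_trans (VM t))// ltry.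
have mV : measurable_fun setT (fun t => mine (U t) M%:E) by exact: measurable_mine.
exists (fun t => fine (mine (U t) M%:E)); split.
- exact: measurableT_comp.
- by move=> t; rewrite ler_norml -!lee_fin fineK// EFinN (le_trans (Mh t))//=.
- by move=> t; rewrite -lee_fin fineK.
- rewrite (eq_integral (fun t => mine (U t) M%:E)); last first.
    by move=> t _; rewrite fineK.
  by apply: le_integral_measurable => // t; rewrite ge_min lexx.
Qed.

Lemma outer_expectation_bound (h : T -> R) (M : R) :
  (forall t, `|h t| <= M)%R -> `|outer_expectation P (EFin \o h)| <= M%:E.
Proof.
move=> hM.
suff [] : - M%:E <= outer_expectation P (EFin \o h) /\
    outer_expectation P (EFin \o h) <= M%:E.
  by case: outer_expectation => [r| |]//=; rewrite !lee_fin ler_norml => -[-> ->].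
split; last first.
  rewrite -[leRHS]integral_cst_probability.
  apply: (@outer_expectation_le h (cst M) `|M|%R) => // t.
  exact: le_trans (ler_norm _) (hM t).
apply: le_ereal_inf_tmp => _ [U [mU _ hU] <-].
have [V [mV VM hV VU]] := bounded_majorant hM mU hU.
apply: le_trans VU; rewrite -EFinN -integral_cst_probability.
apply: le_integral_measurable => [//||t]; first exact/measurable_EFinP.
by rewrite lee_fin; have := VM t; rewrite ler_norml => /andP[].
Qed.

Lemma outer_expectation_fin_num (h : T -> R) (M : R) :
  (forall t, `|h t| <= M)%R -> outer_expectation P (EFin \o h) \is a fin_num.
Proof.
move=> /outer_expectation_bound hM.
by rewrite -abse_fin_num ge0_fin_numE// (le_lt_trans hM)// ltry.
Qed.

Lemma outer_expectation_adherent (h : T -> R) (M e : R) :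
  (forall t, `|h t| <= M)%R -> (0 < e)%R ->
  exists V : T -> R, [/\ measurable_fun setT V, (forall t, `|V t| <= M)%R,
    (forall t, h t <= V t)%R &
    \int[P]_t (V t)%:E <= outer_expectation P (EFin \o h) + e%:E].
Proof.
move=> hM e0.
have [_ [U [mU _ hU] <-] Ue] :=
  lb_ereal_inf_adherent e0 (outer_expectation_fin_num hM).
have [V [mV VM hV VU]] := bounded_majorant hM mU hU.
by exists V; split=> //; exact: le_trans VU (ltW Ue).
Qed.

Lemma outer_expectation_sub (h k1 k2 : T -> R) (M1 M2 : R) :
  (forall t, `|k1 t| <= M1)%R -> (forall t, `|k2 t| <= M2)%R ->
  (forall t, h t <= k1 t + k2 t)%R ->
  outer_expectation P (EFin \o h) <=
    outer_expectation P (EFin \o k1) + outer_expectation P (EFin \o k2).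
Proof.
move=> k1M k2M hk; apply/lee_addgt0Pr => e e0.
have e20 : (0 < e / 2)%R by rewrite divr_gt0.
have [V1 [mV1 V1M kV1 V1e]] := outer_expectation_adherent k1M e20.
have [V2 [mV2 V2M kV2 V2e]] := outer_expectation_adherent k2M e20.
apply: (@le_trans _ _ (\int[P]_t (V1 t + V2 t)%:E)).
  apply: (@outer_expectation_le _ _ (M1 + M2)%R).
  - exact: measurable_funD.
  - by move=> t; rewrite (le_trans (ler_normD _ _))// lerD.
  - by move=> t; rewrite (le_trans (hk t))// lerD.
under eq_integral do rewrite EFinD.
rewrite integralD//=; last 2 first.
- exact: integrable_bounded mV1 V1M.
- exact: integrable_bounded mV2 V2M.
rewrite [e in leRHS]splitr EFinD [leRHS]addeACA; exact: leeD.
Qed.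

Lemma outer_prob_le (A B : set T) : A `<=` B ->
  outer_prob P A <= outer_prob P B.
Proof.
move=> AB; apply: le_ereal_inf_tmp => _ [U [mU iU hU] <-].
apply: ereal_inf_lbound; exists U => //.
split=> // t; apply: le_trans (hU t); rewrite /= lee_fin !indicE ler_nat.
have [tA|//] := boolP (t \in A).
by rewrite mem_set//; apply: AB; rewrite inE in tA.
Qed.

Lemma outer_probU (A B : set T) :
  outer_prob P (A `|` B) <= outer_prob P A + outer_prob P B.
Proof.
apply: (@outer_expectation_sub _ _ _ 1%R 1%R) => t.
- by rewrite ger0_norm// indicE lern1 leq_b1.
- by rewrite ger0_norm// indicE lern1 leq_b1.
- rewrite !indicE in_setU.
  by case: (_ \in A) (_ \in B) => -[]; rewrite /= ?addr0 ?add0r// lerDl.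
Qed.

Lemma outer_prob_ge0 (A : set T) : 0 <= outer_prob P A.
Proof.
by apply: le_ereal_inf_tmp => _ [U [_ _ hU] <-]; apply: integral_ge0 => t _;
  apply: le_trans (hU t); rewrite lee_fin.
Qed.

Lemma outer_prob_fin_num (A : set T) : outer_prob P A \is a fin_num.
Proof.
apply: (@outer_expectation_fin_num _ 1%R) => t.
by rewrite ger0_norm// indicE lern1 leq_b1.
Qed.

(** A near-optimal majorant of [h], divided by [c], is a majorant of the
    indicator of the event. *)
Lemma outer_markov (h : T -> R) (M c : R) : (0 < c)%R ->
  (forall t, 0 <= h t <= M)%R ->
  c%:E * outer_prob P [set t | c <= h t]%R <= outer_expectation P (EFin \o h).
Proof.
move=> c0 hM; apply/lee_addgt0Pr => e e0.
have hM' t : (`|h t| <= M)%R.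
  by case/andP: (hM t) => h0 h1; rewrite ger0_norm.
have [V [mV VM hV Ve]] := outer_expectation_adherent hM' e0.
apply: le_trans Ve; rewrite -lee_pdivlMl//.
have iV := integrable_bounded mV VM.
rewrite -integralZl//.
apply: (@outer_expectation_le _ (fun t => c^-1 * V t)%R (c^-1 * M)%R).
- exact: measurable_funM.
- by move=> t; rewrite normrM gtr0_norm ?invr_gt0// ler_pM2l ?invr_gt0.
- move=> t; rewrite indicE; have [/set_mem/= ct|_] := boolP (t \in _).
    by rewrite ler_pdivlMl// mulr1 (le_trans ct).
  by rewrite mulr_ge0 ?invr_ge0 ?(ltW c0)// (le_trans _ (hV t))//; case/andP: (hM t).
Qed.

End outer_expectation_bounded.

Section outer_expectation_close.
Context {R : realType} (d : measure_display) (T : measurableType d).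
Variable P : probability T R.
Local Open Scope ereal_scope.

(** Off [A] the two maps differ by at most [c], and on [A] by at most 2; this
    is why the outer probability of [A] is counted twice. *)
Lemma outer_expectation_close (k1 k2 : T -> R) (A : set T) (c : R) :
  (0 <= c)%R -> (forall t, `|k1 t| <= 1)%R -> (forall t, `|k2 t| <= 1)%R ->
  (forall t, ~ A t -> `|k1 t - k2 t| <= c)%R ->
  `|outer_expectation P (EFin \o k1) - outer_expectation P (EFin \o k2)| <=
    c%:E + (outer_prob P A + outer_prob P A).
Proof.
move=> c0.
have half (h1 h2 : T -> R) : (forall t, `|h1 t| <= 1)%R ->
    (forall t, `|h2 t| <= 1)%R -> (forall t, ~ A t -> `|h1 t - h2 t| <= c)%R ->
    outer_expectation P (EFin \o h1) <= outer_expectation P (EFin \o h2) +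
      (c%:E + (outer_prob P A + outer_prob P A)).
  move=> h11 h21 h12.
  have indM t : (`|(\1_A t : R)| <= 1)%R.
    by rewrite ger0_norm// indicE lern1 leq_b1.
  have indM2 t : (`|\1_A t + \1_A t : R| <= 1 + 1)%R.
    by rewrite (le_trans (ler_normD _ _))// lerD.
  have cM (t : T) : (`|cst c t| <= c)%R by rewrite ger0_norm.
  have kM t : (`|c + (\1_A t + \1_A t) : R| <= c + (1 + 1))%R.
    by rewrite (le_trans (ler_normD _ _))// lerD// (cM t).
  apply: le_trans (outer_expectation_sub P h21 kM _) _.
    move=> t; rewrite -lerBlDl (le_trans (ler_norm _))//.
    have [At|At] := pselect (A t); last first.
      by rewrite (le_trans (h12 _ At))// lerDl addr_ge0.
    rewrite indicE mem_set//= (le_trans (ler_normB _ _))// ler_wpDl//.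
    exact: lerD.
  rewrite leeD2l//.
  apply: le_trans (outer_expectation_sub P cM indM2 (fun t => lexx _)) _.
  apply: leeD.
    exact: le_trans (lee_abs _) (outer_expectation_bound P cM).
  exact: (outer_expectation_sub P indM indM (fun t => lexx _)).
move=> k11 k21 k12.
have := half _ _ k11 k21 k12.
have k21' t : ~ A t -> (`|k2 t - k1 t| <= c)%R by rewrite distrC; exact: k12.
have {half} := half _ _ k21 k11 k21'.
rewrite -(fineK (outer_expectation_fin_num P k11)).
rewrite -(fineK (outer_expectation_fin_num P k21)).
rewrite -(fineK (outer_prob_fin_num P A)).
by rewrite /= !lee_fin ler_norml => h1 h2; apply/andP; split; lra.
Qed.

End outer_expectation_close.

(** * Events of vanishing outer probability *)

Section vanishing.
Context {R : realType} (d : measure_display) (X : measurableType d).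
Variable P0 : probability X R.
Local Open Scope ereal_scope.

Definition vanishing (A : forall n, set (n.+1.-tuple X)) : Prop :=
  outer_prob (iid_law P0 n.+1) (A n) @[n --> \oo] --> 0.

Lemma vanishing_sub (A B : forall n, set (n.+1.-tuple X)) :
  (forall n, A n `<=` B n) -> vanishing B -> vanishing A.
Proof.
move=> AB vB; apply: squeeze_cvge; [|exact: cvg_cst|exact: vB].
by apply: nearW => n; rewrite outer_prob_ge0/=; exact/outer_prob_le/AB.
Qed.

Lemma vanishingU (A B : forall n, set (n.+1.-tuple X)) :
  vanishing A -> vanishing B -> vanishing (fun n => A n `|` B n).
Proof.
move=> vA vB; have vAB := cvgeD (erefl : 0 +? 0) vA vB; rewrite adde0 in vAB.
apply: squeeze_cvge; [|exact: cvg_cst|exact: vAB].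
by apply: nearW => n; rewrite outer_prob_ge0 outer_probU.
Qed.

End vanishing.

(** * Lipschitz maps and Borel measurability *)

Section lipschitz.
Context {R : realType} {D D' : metricType R}.

Lemma lipschitz_continuous (f : D -> D') (k : R) : 0 < k ->
  (forall x y, mdist (f x) (f y) <= k * mdist x y) -> continuous f.
Proof.
move=> k0 fk x; apply/metricType_numDomainType.cvgrPdist_lt => e e0.
apply/metricType_numDomainType.nbhs_mdistP; exists (e / k).
  by rewrite /= divr_gt0.
by move=> y /= xy; rewrite (le_lt_trans (fk _ _))// -ltr_pdivlMl// mulrC.
Qed.

End lipschitz.

Section borel_lipschitz.
Context {R : realType} (d : measure_display) (O : measurableType d).
Context (D : metricType R).

Lemma borel_measurable_real (G : O -> D) (f : D -> R) :
  borel_measurable G -> continuous (f : D -> R^o) ->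
  measurable_fun setT (f \o G).
Proof.
move=> mG cf; apply: measurability (RGenOInfty.measurableE R) _.
move=> _ [_ [a ->] <-]; rewrite setTI comp_preimage.
apply: mG; move/continuousP : cf; apply.
by rewrite set_itvE; exact: open_gt.
Qed.

End borel_lipschitz.

(** * Oscillation of a bounded function around an index *)

Section oscillation.
Context {R : realType} (T : Type) (B : set T) (t0 : T).
Hypothesis Bt0 : B t0.
Implicit Types z : linf (R := R) T.

Definition osc z : R := sup [set `|z t - z t0| | t in B].

Lemma osc_ge z t : B t -> `|z t - z t0| <= osc z.
Proof.
move=> Bt; apply: ub_le_sup; last by exists t.
have [M zM] := linf_bounded z; exists (M + M) => _ [u _ <-].
by rewrite (le_trans (ler_normB _ _))// lerD.
Qed.

Lemma osc_le z (c : R) : (forall t, B t -> `|z t - z t0| <= c) -> osc z <= c.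
Proof.
by move=> zc; apply: ge_sup => [|_ [t Bt <-]]; [exists `|z t0 - z t0|, t0|exact: zc].
Qed.

Lemma osc_ge0 z : 0 <= osc z.
Proof. exact: le_trans (osc_ge z Bt0). Qed.

Lemma osc_lip z1 z2 : `|osc z1 - osc z2| <= 2 * mdist z1 z2.
Proof.
have half y1 y2 : osc y1 <= osc y2 + 2 * mdist y1 y2.
  apply: osc_le => t Bt.
  have := osc_ge y2 Bt; have := linf_dist_ge y1 y2 t; have := linf_dist_ge y1 y2 t0.
  rewrite -[linf_dist y1 y2]/(mdist y1 y2) !ler_norml.
  by move=> /andP[? ?] /andP[? ?] /andP[? ?]; apply/andP; split; lra.
rewrite ler_norml; have := half z1 z2; have := half z2 z1.
by rewrite (metric_sym z2 z1) => ? ?; apply/andP; split; lra.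
Qed.

(** The oscillation is 2-Lipschitz, each of the two values moving by at most
    the supremum distance; halving and truncating it gives a member of
    [BL1]. *)
Definition trunc_osc z : R := Num.min 1 (osc z / 2).

Lemma trunc_osc_bounds z : 0 <= trunc_osc z <= 1.
Proof.
by rewrite /trunc_osc le_min ler01 divr_ge0 ?osc_ge0//= ge_min lexx.
Qed.

Lemma BL1_trunc_osc : BL1 trunc_osc.
Proof.
split=> [z|z1 z2].
  by have /andP[? ?] := trunc_osc_bounds z; rewrite ger0_norm.
rewrite /trunc_osc; have := osc_lip z1 z2; rewrite !ler_norml => /andP[h1 h2].
by apply/andP; split; rewrite /Num.min; do 2 case: ifPn; rewrite -?leNgt => *; lra.
Qed.

End oscillation.

(** * Tight processes oscillate little near an index *)

Section cells.
Context {R : realType} (T : Type).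

(** The cell of [t] records, for each function [z] of the list, the integer
    part of [z t / e], after a shift by a bound of [z] that makes it a natural
    number. *)
Lemma finite_cells (s : seq (linf (R := R) T)) (e : R) : 0 < e ->
  exists (C : finType) (cell : T -> C),
    forall z, z \in s -> forall t u, cell t = cell u -> `|z t - z u| <= e.
Proof.
move=> e0; elim: s => [|z s [C [cell cellP]]]; first by exists unit, (fun=> tt).
have [M zM] := linf_bounded z.
pose k t := Num.truncn ((z t + M) / e).
pose N := (Num.truncn ((M + M) / e)).
have zM0 t : 0 <= (z t + M) / e.
  by have := zM t; rewrite ler_norml => /andP[? ?]; rewrite divr_ge0 ?(ltW e0)//; lra.
have kN t : (k t < N.+1)%N.
  rewrite ltnS; apply: le_truncn; rewrite ler_pM2r ?invr_gt0// lerD2r.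
  exact: le_trans (ler_norm _) (zM t).
exists (C * 'I_N.+1)%type, (fun t => (cell t, inord (k t))) => y.
rewrite inE => /orP[/eqP -> {y}|ys] t u [ctu]; last by move=> _; exact: (cellP y).
move=> /(congr1 val); rewrite /= !inordK// => ktu.
have /andP[] := truncn_itv (zM0 t); have /andP[] := truncn_itv (zM0 u).
rewrite -/(k t) -/(k u) -ktu.
rewrite !ler_pdivlMr// !ltr_pdivrMr// -natr1 mulrDl mul1r ler_norml => *.
by apply/andP; split; lra.
Qed.

End cells.

Section union_bound.
Context {R : realType} (d : measure_display) (O : measurableType d).
Variable P : probability O R.

Lemma uniform_union_bound (I : eqType) (s : seq I) (A : I -> set O) (e : R) :
  (forall i, measurable (A i)) -> (forall i, P (A i) <= e%:E)%E ->
  measurable (\big[setU/set0]_(i <- s) A i) /\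
  (P (\big[setU/set0]_(i <- s) A i) <= ((size s)%:R * e)%:E)%E.
Proof.
move=> mA Ae; elim: s => [|i s [ms Ps]]; first by rewrite big_nil measure0 mul0r.
rewrite big_cons; split; first exact: measurableU.
apply: le_trans (measureU2 _ (mA i) ms) _.
by rewrite /= -natr1 mulrDl mul1r addrC EFinD leeD.
Qed.

End union_bound.

Lemma compact_finite_net {R : realType} (D : metricType R) (K : set D) (e : R) :
  0 < e -> compact K ->
  exists s : seq D, forall z, K z -> exists2 y, y \in s & mdist y z < e.
Proof.
move=> e0 cK; have [[z0 _]|K0] := pselect (exists z, K z); last first.
  by exists [::] => z Kz; case: K0; exists z.
(* A member of [K] serves as the base point of the space. *)
pose Dp : ptopologicalType :=
  HB.pack (D : Type) (D : topologicalType) (isPointed.Build D z0).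
have : @cover_compact Dp K by rewrite -compact_cover.
move=> /(_ _ K (fun z => (ball z e)°)) [].
- by move=> z _; exact: open_interior.
- by move=> z Kz; exists z => //; exact: nbhsx_ballx.
move=> s sK Ks; exists (finmap.enum_fset s) => z /Ks[y ys yz]; exists y => //.
by have := interior_subset yz; rewrite ballEmdist.
Qed.

Section tight_process.
Context {R : realType} (d : measure_display) (O : measurableType d).
Variables (P : probability O R) (T : Type) (G : O -> linf (R := R) T).
Hypotheses (mG : borel_measurable G) (tG : tight P G).

Lemma linf_eval_continuous (t : T) : continuous (fun z : linf (R := R) T => z t : R^o).
Proof.
apply: (@lipschitz_continuous _ _ _ _ 1) => // x y.
by rewrite mul1r {1}/mdist/= distrC linf_dist_ge.
Qed.

Lemma measurable_eval (t : T) : measurable_fun setT (fun o => G o t).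
Proof. exact: borel_measurable_real mG (@linf_eval_continuous t). Qed.

(** Tightness upgrades continuity in probability at [t0], for the closeness
    measured by [r], to a bound uniform over a neighbourhood.  With [e] cut into
    four parts, two bound the truncated oscillation outside the exceptional
    event, and one each bounds the probability of leaving the compact set and
    that of a large increment at the representative of some cell. *)
Lemma tight_osc (t0 : T) (r : T -> \bar R) : (r t0 <= 0)%E ->
  (forall eps eta : R, 0 < eps -> 0 < eta -> exists2 delta : R, 0 < delta &
     forall t, (r t < delta%:E)%E ->
       (P [set o | eps <= `|G o t - G o t0|]%R <= eta%:E)%E) ->
  forall e : R, 0 < e -> exists2 delta : R, 0 < delta &
    (\int[P]_o (trunc_osc [set t | r t < delta%:E]%E t0 (G o))%:E <= e%:E)%E.
Proof.
move=> rt0 rG e e0; pose a := e / 4.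
have a0 : 0 < a by rewrite divr_gt0.
have [K [cK PK]] := tG a0.
have [s sK] := compact_finite_net a0 cK.
have [C [cell cellP]] := finite_cells s a0.
have C0 : 0 < #|C|%:R :> R by rewrite ltr0n; apply/card_gt0P; exists (cell t0).
have [delta delta0 rdelta] := rG a (a / #|C|%:R) a0 (divr_gt0 a0 C0).
exists delta => //; set B := [set t | _].
have Bt0 : B t0 by rewrite /B/= (le_lt_trans rt0)// lte_fin.
(* A cell that meets [B] is represented by a member of [B]; the other cells
   get [t0], which keeps the bound [rdelta] valid for every cell. *)
have [f fP] : {f : C -> T & forall c, B (f c) /\
    (forall t, B t -> cell t = c -> cell (f c) = c)}.
  apply: (@choice C T (fun c u => B u /\ forall t, B t -> cell t = c -> cell u = c)) => c.
  have [[t [Bt <-]]|nB] := pselect (exists t, B t /\ cell t = c); first by exists t.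
  by exists t0; split=> // t Bt tc; case: nB; exists t.
pose A c := [set o | a <= `|G o (f c) - G o t0|].
have mA c : measurable (A c).
  have -> : A c = (fun o => `|G o (f c) - G o t0|) @^-1` `[a, +oo[.
    by apply/seteqP; split=> o /=; rewrite in_itv/= andbT.
  rewrite -[X in measurable X]setTI.
  by apply: measurableT_comp => //; apply: measurable_funB; exact: measurable_eval.
have [mU PU] := uniform_union_bound (enum C) mA (fun c => rdelta _ (fP c).1).
rewrite -cardE mulrC divfK ?gt_eqF// in PU.
set U := \big[_/_]_(_ <- _) _ in mU PU.
have mK : measurable (G @^-1` ~` K).
  apply: mG; apply: closed_openC.
  by apply: compact_closed => //; exact: metric_hausdorff.
have c_osc : continuous (trunc_osc B t0 : linf (R := R) T -> R^o).
  apply: (@lipschitz_continuous R _ R^o _ 1 ltr01) => x y.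
  by rewrite mul1r {1}/mdist/= distrC; exact: (BL1_trunc_osc Bt0).2.
have m_osc := borel_measurable_real mG c_osc.
have mbad : measurable ((G @^-1` ~` K) `|` U) by exact: measurableU.
apply: (@le_trans _ _ (\int[P]_o (2 * a + \1_((G @^-1` ~` K) `|` U) o)%:E)%E).
  apply: le_integral_measurable.
  - exact/measurable_EFinP.
  - by apply/measurable_EFinP; apply: measurable_funD => //; exact: measurable_indic.
  move=> o; rewrite lee_fin; have [bad|nbad] := pselect (((G @^-1` ~` K) `|` U) o).
    rewrite indicE mem_set//=; have /andP[_ le1] := trunc_osc_bounds Bt0 (G o).
    by rewrite (le_trans le1)// lerDr mulr_ge0// ltW.
  have [/contrapT Ko nU] := iffLR (not_orP _ _) nbad.
  rewrite indicE memNset ?addr0; last by case.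
  rewrite /trunc_osc ge_min; apply/orP; right.
  rewrite ler_pdivrMr//; apply: osc_le => // t Bt.
  have [y ys yG] := sK _ Ko.
  have [Bf ft] := fP (cell t).
  have := cellP y ys t (f (cell t)) (esym (ft t Bt erefl)).
  have nA : ~ A (cell t) o.
    move=> Ao; apply: nU; rewrite /U -bigcup_seq.
    by exists (cell t); rewrite /= ?mem_enum.
  have {nA} : `|G o (f (cell t)) - G o t0| < a by rewrite ltNge; apply/negP.
  have := le_lt_trans (linf_dist_ge y (G o) t) yG.
  have := le_lt_trans (linf_dist_ge y (G o) (f (cell t))) yG.
  rewrite !ler_norml !ltr_norml => /andP[? ?] /andP[? ?] /andP[? ?] /andP[? ?].
  by apply/andP; split; lra.
under eq_integral do rewrite EFinD.
rewrite integralD//; last 2 first.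
- apply: (@integrable_bounded _ _ _ P (cst (2 * a)) `|2 * a|) => //.
- apply: (@integrable_bounded _ _ _ P _ 1) => //.
  by move=> o; rewrite ger0_norm// indicE lern1 leq_b1.
rewrite integral_cst_probability integral_indic// setIT.
apply: (@le_trans _ _ ((2 * a)%:E + (a%:E + a%:E))%E).
  by rewrite leeD2l// (le_trans (measureU2 _ _ _))// leeD.
by rewrite -!EFinD lee_fin /a; lra.
Qed.

End tight_process.

(** * Increments of the Brownian bridge *)

Section square_integrable.
Context {R : realType} (d : measure_display) (T : measurableType d).
Variable P : probability T R.
Local Open Scope ereal_scope.

Lemma Lnorm2_sqr (f : T -> R) :
  'N[P]_2%:E[EFin \o f] `^ 2 = \int[P]_t ((f t) ^+ 2)%:E.
Proof.
rewrite poweR_Lnorm//; apply: eq_integral => t _.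
by rewrite /= powR_mulrn// real_normK// num_real.
Qed.

Lemma Lfun2P (f : T -> R) : measurable_fun setT f ->
  \int[P]_t ((f t) ^+ 2)%:E < +oo -> f \in Lfun P 2%:E.
Proof.
move=> mf f2; rewrite inE; apply/andP; split; rewrite inE//=.
by rewrite /finite_norm (@lty_poweRy _ _ 2)// Lnorm2_sqr.
Qed.

Lemma Lfun2_Lfun1 (f : T -> R) : f \in Lfun P 2%:E -> f \in Lfun P 1.
Proof. by apply: Lfun_subset12; exact: fin_num_measure. Qed.

Lemma covariance_pint (f g : T -> R) :
  f \in Lfun P 2%:E -> g \in Lfun P 2%:E ->
  covariance P f g =
    (pint P (fun t => f t * g t) - pint P f * pint P g)%:E.
Proof.
move=> f2 g2; have f1 := Lfun2_Lfun1 f2; have g1 := Lfun2_Lfun1 g2.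
have fg1 := Lfun2_mul_Lfun1 f2 g2.
rewrite covarianceE// EFinB EFinM /pint /Rintegral.
have E h : h \in Lfun P 1 -> (fine (\int[P]_t (h t)%:E))%:E = 'E_P[h].
  by move=> h1; rewrite -[in RHS](fineK (expectation_fin_num h1)) unlock.
by rewrite (E _ f1) (E _ g1) (E _ fg1).
Qed.

Lemma variance_le_sqr (f : T -> R) : f \in Lfun P 2%:E ->
  'V_P[f] <= \int[P]_t ((f t) ^+ 2)%:E.
Proof.
move=> f2; rewrite varianceE//; have := expectation_fin_num (Lfun2_Lfun1 f2).
move=> /fineK <-; rewrite leeBlDr// -[leLHS]adde0 leeD//.
  by rewrite unlock.
exact: sqre_ge0.
Qed.

End square_integrable.

Section bridge_increments.
Context {R : realType} (d d' : measure_display).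
Context (X : measurableType d) (O : measurableType d').
Variables (P0 : probability X R) (F : set (X -> R)) (P : probability O R).
Variable G : O -> linf (R := R) F.
Hypothesis F_meas : forall f, F f -> measurable_fun setT f.
Hypothesis bridge : brownian_bridge P0 P G.
Local Open Scope ereal_scope.

Lemma bridge_class_L2 (f : F) : set_val f \in Lfun P0 2%:E.
Proof.
have [_ _ _ F2 _] := bridge; have Ff : F (set_val f) by exact: set_valP.
by apply: Lfun2P; [exact: F_meas|exact: F2].
Qed.

(** The mean being zero, the second moment is the covariance of the process
    with itself at [f], to which the bridge gives a finite value. *)
Lemma bridge_L2 (f : F) : (fun o => G o f) \in Lfun P 2%:E.
Proof.
have [mG _ _ _ /(_ f f)[E0]] := bridge; rewrite unlock E0 => cov.
apply: Lfun2P; first exact: measurable_eval.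
have -> : \int[P]_o ((G o f) ^+ 2)%:E =
    'E_P[((fun o => G o f) \- cst (fine 0)) * ((fun o => G o f) \- cst (fine 0))]%R.
  rewrite unlock; apply: eq_integral => o _.
  by rewrite /= !fctE/= subr0 expr2.
by rewrite cov ltry.
Qed.

(** Chebyshev's inequality: the bridge has the covariance of the index
    functions under [P0], so the variance of an increment is the [P0]-variance
    of the difference of the indices, hence at most its second moment. *)
Lemma bridge_increment (f g : F) (eps : R) : (0 < eps)%R ->
  P [set o | eps <= `|G o f - G o g|]%R <=
    (eps ^- 2)%:E * \int[P0]_z ((set_val f z - set_val g z) ^+ 2)%:E.
Proof.
move=> eps0; have [mG _ _ _ cov] := bridge.
have f2 := bridge_class_L2 f; have g2 := bridge_class_L2 g.
have Gf2 := bridge_L2 f; have Gg2 := bridge_L2 g.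
pose Z := ((fun o => G o f) \- (fun o => G o g))%R.
have covE u v : covariance P (fun o => G o u) (fun o => G o v) =
    covariance P0 (set_val u) (set_val v).
  by rewrite (cov u v).2 covariance_pint// bridge_class_L2.
have VE : 'V_P[Z] = 'V_P0[(set_val f \- set_val g)%R].
  by rewrite !varianceB// /variance !covE.
have E0 : 'E_P[Z] = 0.
  by rewrite expectationB ?Lfun2_Lfun1// (cov f g).1 (cov g f).1 sube0.
have mZ : measurable_fun setT Z by apply: measurable_funB; exact: measurable_eval.
have /= := chebyshev (mfun_Sub (mem_set mZ) : {RV P >-> R}) eps0.
rewrite E0 VE; under eq_set do rewrite subr0.
move=> /le_trans; apply; rewrite lee_pmul2l ?lte_fin ?invr_gt0 ?exprn_gt0//.
by apply: variance_le_sqr; rewrite rpredB ?lee1n.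
Qed.

End bridge_increments.

(** The radius [eps * sqrt eta] makes the Chebyshev bound
    [eps ^- 2 * delta ^+ 2] equal to [eta]. *)
Lemma bridge_continuous {R : realType} (d d' : measure_display)
    (X : measurableType d) (O : measurableType d')
    (P0 : probability X R) (F : set (X -> R)) (P : probability O R)
    (G : O -> linf (R := R) F) (f0 : F) :
  (forall f, F f -> measurable_fun setT f) -> brownian_bridge P0 P G ->
  forall e : R, 0 < e -> exists2 delta : R, 0 < delta &
    (\int[P]_o (trunc_osc
      [set f : F | ('N[P0]_2%:E[(fun z => (set_val f z - set_val f0 z)%:E)] < delta%:E)%E]
      f0 (G o))%:E <= e%:E)%E.
Proof.
move=> F_meas bridge; have [mG tG _ _ _] := bridge.
apply: tight_osc => //.
  rewrite (_ : (fun z => _) = cst 0%E) ?Lnorm0//.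
  by apply/funext => z; rewrite subrr.
move=> eps eta eps0 eta0; exists (eps * Num.sqrt eta).
  by rewrite mulr_gt0// sqrtr_gt0.
move=> f f_near; apply: le_trans (bridge_increment F_meas bridge f f0 eps0) _.
rewrite lee_pdivrMl ?exprn_gt0//.
rewrite -(Lnorm2_sqr P0 (fun z => set_val f z - set_val f0 z)).
apply: (@le_trans _ _ ((eps * Num.sqrt eta)%:E `^ 2)%E).
  apply: gt0_ler_poweR; rewrite ?in_itv/= ?leey ?andbT ?Lnorm_ge0//.
  - by rewrite lee_fin mulr_ge0// ltW.
  - exact: ltW f_near.
by rewrite poweR_EFin powR_mulrn ?mulr_ge0 ?(ltW eps0)// lee_fin exprMn sqr_sqrtr// ltW.
Qed.

(** * Conditional convergence in outer probability *)

Section conditional_events.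
Context {R : realType} (dX : measure_display) (X : measurableType dX).
Context (dW : nat -> measure_display) (W : forall n, measurableType (dW n)).
Variables (P0 : probability X R) (Q : forall n, probability (W n) R).
Local Open Scope ereal_scope.

(** Fixing the level [eta], instead of asking for all levels at once, lets the
    events depend on [eta]; the radius of the ball in the oscillation event of
    the main proof does. *)
Definition cond_small (eta : R)
    (B : forall n, n.+1.-tuple X -> set (n.+1.-tuple (W n))) : Prop :=
  vanishing P0
    (fun n => [set x | eta%:E <= outer_prob (iid_law (Q n) n.+1) (B n x)]).

Lemma cond_smallU (eta1 eta2 : R)
    (B B1 B2 : forall n, n.+1.-tuple X -> set (n.+1.-tuple (W n))) :
  (forall n x, B n x `<=` B1 n x `|` B2 n x) ->
  cond_small eta1 B1 -> cond_small eta2 B2 -> cond_small (eta1 + eta2) B.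
Proof.
move=> BB s1 s2; apply: vanishing_sub (vanishingU s1 s2) => n x /=.
move=> le12; apply/orP; rewrite -[_ || _]negbK negb_or -!ltNge.
apply/negP => /andP[lt1 lt2]; move: le12; rewrite leNgt EFinD => /negP; apply.
apply: le_lt_trans (outer_prob_le _ (BB n x)) _.
by apply: le_lt_trans (outer_probU _ _ _) _; exact: lteD.
Qed.

Lemma abse_outer_prob n (B : set (n.+1.-tuple (W n))) :
  `|outer_prob (iid_law (Q n) n.+1) B - 0%:E| = outer_prob (iid_law (Q n) n.+1) B.
Proof. by rewrite sube0 gee0_abs// outer_prob_ge0. Qed.

Lemma oPWP (r : nat -> R)
    (Y : forall n, n.+1.-tuple X -> n.+1.-tuple (W n) -> \bar R) :
  oPW P0 Q r Y <-> forall eps eta : R, (0 < eps)%R -> (0 < eta)%R ->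
    cond_small eta
      (fun n x => [set w | (eps%:E <= `|Y n x w * ((r n)^-1)%:E|)%E]).
Proof.
split=> h eps.
  move=> eta eps0 eta0; apply: vanishing_sub (h eps eps0 eta eta0) => n x /=.
  by rewrite abse_outer_prob.
move=> eps0 eta eta0; apply: vanishing_sub (h eps eta eps0 eta0) => n x /=.
by rewrite abse_outer_prob.
Qed.

Lemma cond_small_inner_prob (eta : R)
    (A : forall n, n.+1.-tuple X -> set (n.+1.-tuple (W n))) :
  (0 < eta)%R ->
  cvg_outer_prob P0 (fun n x => inner_prob (iid_law (Q n) n.+1) (A n x)) 1 ->
  cond_small eta (fun n x => ~` A n x).
Proof.
move=> eta0 /(_ eta eta0); apply: vanishing_sub => n x /=.
rewrite /inner_prob; have := outer_prob_ge0 (iid_law (Q n) n.+1) (~` A n x).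
have /fineK <- := outer_prob_fin_num (iid_law (Q n) n.+1) (~` A n x).
rewrite -!EFinB !lee_fin => p0.
by rewrite addrAC subrr sub0r normrN ger0_norm.
Qed.

Section weak_convergence.
Context (D : metricType R).
Variable G : forall n, n.+1.-tuple X -> n.+1.-tuple (W n) -> D.
Context (dO : measure_display) (O : measurableType dO).
Variables (P : probability O R) (G0 : O -> D).
Hypothesis GG0 : cond_weak_cvg P0 Q G P G0.

Lemma cond_weak_cvg_BL1 (h : D -> R) (c : R) : BL1 h -> (0 < c)%R ->
  vanishing P0 (fun n => [set x | c%:E <=
    `|outer_expectation (iid_law (Q n) n.+1) (fun w => (h (G x w))%:E) -
      \int[P]_o (h (G0 o))%:E|]).
Proof.
move=> hBL c0; have [_ _ /(_ c c0)] := GG0; apply: vanishing_sub => n x /= ch.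
rewrite sube0 (le_trans _ (lee_abs _))// (le_trans ch)//.
by apply: ereal_sup_ubound; exists h.
Qed.

(** By Markov's inequality the event has conditional probability [eta] only if
    the expectation of [h] is at least [tau * eta], twice the bound assumed on
    its limit, hence [tau * eta / 2] away from the latter. *)
Lemma cond_weak_cvg_small (h : D -> R) (tau eta : R) : BL1 h ->
  (forall z, 0 <= h z)%R -> (0 < tau)%R -> (0 < eta)%R ->
  \int[P]_o (h (G0 o))%:E <= (tau * eta / 2)%:E ->
  cond_small eta (fun n x => [set w | tau <= h (G x w)]%R).
Proof.
move=> hBL h0 tau0 eta0 hint.
have c0 : (0 < tau * eta / 2)%R by rewrite divr_gt0// mulr_gt0.
apply: vanishing_sub (cond_weak_cvg_BL1 hBL c0) => n x /= etaP.
have hbd w : (0 <= h (G x w) <= 1)%R.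
  by rewrite h0/=; apply: le_trans (ler_norm _) _; exact: hBL.1.
have := outer_markov (iid_law (Q n) n.+1) tau0 hbd.
have hfin := outer_expectation_fin_num (iid_law (Q n) n.+1) (fun w => hBL.1 (G x w)).
have i0 : 0 <= \int[P]_o (h (G0 o))%:E by apply: integral_ge0 => o _; rewrite lee_fin.
have ifin : \int[P]_o (h (G0 o))%:E \is a fin_num.
  by rewrite ge0_fin_numE// (le_lt_trans hint)// ltry.
move: hint etaP; rewrite /comp in hfin *; rewrite -(fineK ifin) -(fineK hfin).
rewrite -(fineK (outer_prob_fin_num _ _)) -EFinB -EFinM /= !lee_fin.
set i := fine _; set e := fine _; set p := fine _ => hi hp mark.
rewrite (le_trans _ (ler_norm _))//.
have := ler_wpM2l (ltW tau0) hp; lra.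
Qed.

(** Composition with the 1-Lipschitz [f] keeps test functions in [BL1], so the
    convergence of [f (G n x w)] is uniform over them; moving to [Y] costs each
    of them at most [eps / 4] plus twice the conditional probability that the
    two are [eps / 4] apart, whatever the test function. *)
Lemma cond_weak_cvg_slutsky (D' : metricType R) (f : D -> D')
    (Y : forall n, n.+1.-tuple X -> n.+1.-tuple (W n) -> D') :
  (forall y z, mdist (f y) (f z) <= mdist y z)%R ->
  (forall eps eta : R, (0 < eps)%R -> (0 < eta)%R ->
    cond_small eta (fun n x => [set w | eps <= mdist (Y n x w) (f (G x w))]%R)) ->
  cond_weak_cvg P0 Q Y P (f \o G0).
Proof.
move=> f_lip fY; have [mG tG _] := GG0.
have cf : continuous f.
  by apply: (@lipschitz_continuous _ _ _ _ 1) => // y z; rewrite mul1r.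
have mfG : borel_measurable (f \o G0).
  by move=> U oU; rewrite comp_preimage; apply: mG; move/continuousP : cf; exact.
split=> //.
  move=> eps eps0; have [K [cK PK]] := tG _ eps0.
  have cfK : compact (f @` K).
    by apply: continuous_compact => //; exact: continuous_subspaceT.
  have ocl (E : metricType R) (A : set E) : compact A -> open (~` A).
    move=> cA; apply: closed_openC; apply: compact_closed => //.
    exact: metric_hausdorff.
  exists (f @` K); split=> //; apply: le_trans PK; apply: le_measure.
  - by rewrite inE; apply: mfG; exact: ocl.
  - by rewrite inE; apply: mG; exact: ocl.
  - by move=> o /= nfK Ko; apply: nfK; exists (G0 o).
move=> eps eps0.
have e40 : (0 < eps / 4)%R by rewrite divr_gt0.
have e80 : (0 < eps / 8)%R by rewrite divr_gt0.
have [_ _ /(_ _ e40) sG] := GG0.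
apply: vanishing_sub (vanishingU sG (fY _ _ e40 e80)) => n x /= le_eps.
apply/orP; rewrite -[_ || _]negbK negb_or -!ltNge; apply/negP => /andP[].
move=> supG PY; move: le_eps; rewrite leNgt => /negP; apply.
apply: (@le_lt_trans _ _ (3 * eps / 4)%:E); last by rewrite lte_fin; lra.
set S := [set _ | _ in _]; rewrite sube0.
have S0 : 0 <= ereal_sup S.
  apply: (@le_trans _ _ `|outer_expectation (iid_law (Q n) n.+1) (fun w => 0%:E) -
      \int[P]_o 0%:E|) => //.
  apply: ereal_sup_ubound; exists (fun=> 0%R) => //; split=> [z|y z].
    by rewrite normr0.
  by rewrite subrr normr0 mdist_ge0.
rewrite gee0_abs//; apply: ge_ereal_sup => _ [h [h1 h_lip] <-].
have hfBL : BL1 (h \o f).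
  by split=> [z|y z]; [exact: h1|exact: le_trans (h_lip _ _) (f_lip _ _)].
have hG : `|outer_expectation (iid_law (Q n) n.+1) (fun w => (h (f (G x w)))%:E) -
      \int[P]_o (h (f (G0 o)))%:E| < (eps / 4)%:E.
  rewrite sube0 in supG; apply: le_lt_trans supG; apply: le_trans (lee_abs _).
  by apply: ereal_sup_ubound; exists (h \o f).
have := @outer_expectation_close _ _ _ (iid_law (Q n) n.+1)
  (fun w => h (Y n x w)) (fun w => h (f (G x w)))
  [set w | eps / 4 <= mdist (Y n x w) (f (G x w))]%R (eps / 4)
  (ltW e40) (fun w => h1 _) (fun w => h1 _).
have close w : ~ [set w | eps / 4 <= mdist (Y n x w) (f (G x w))]%R w ->
    (`|h (Y n x w) - h (f (G x w))| <= eps / 4)%R.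
  by move=> /= /negP; rewrite -ltNge => /ltW; exact: le_trans.
move=> /(_ close).
have hYfin := outer_expectation_fin_num (iid_law (Q n) n.+1) (fun w => h1 (Y n x w)).
have hGfin := outer_expectation_fin_num (iid_law (Q n) n.+1) (fun w => h1 (f (G x w))).
have ifin : \int[P]_o (h (f (G0 o)))%:E \is a fin_num.
  move: hG; rewrite -(fineK hGfin); case: integral => //.
move: hG PY; rewrite /comp in hYfin hGfin *.
rewrite -(fineK hYfin) -(fineK hGfin) -(fineK ifin).
rewrite -(fineK (outer_prob_fin_num _ _)) -!EFinB -!EFinD /= !lee_fin !lte_fin.
set a := fine _; set b := fine _; set c := fine _; set p := fine _.
by rewrite !ler_norml !ltr_norml => /andP[? ?] ? /andP[? ?]; apply/andP; split; lra.
Qed.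

End weak_convergence.
End conditional_events.

(** * Replacing the estimated influence function by its limit *)

Theorem theorem3p4 (R : realType)
  (d : nat) (dX : measure_display) (X : measurableType dX)
  (incl : X -> 'rV[R]_d) (incl_inj : injective incl)
  (model : set (probability X R)) (P0 : probability X R) (P0_model : model P0)
  (psi : probability X R -> R) (H : Type) (eta : probability X R -> H)
  (T : H -> probability X R -> R) (psi_T : psi P0 = T (eta P0) P0)
  (phi0 : X -> R) (phi0_mean : pint P0 phi0 = 0)
  (phi0_L2 : (\int[P0]_z ((phi0 z) ^+ 2)%:E < +oo)%E)
  (dW : nat -> measure_display) (W : forall n, measurableType (dW n))
  (Q : forall n, probability (W n) R)
  (gamma : forall n, {mfun (n.+1.-tuple X * W n)%type >-> X})
  (eta_n : forall n, n.+1.-tuple X -> H)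
  (eta_star : forall n, n.+1.-tuple X -> n.+1.-tuple X -> H)
  (phi_star : forall n, n.+1.-tuple X -> n.+1.-tuple X -> X -> R)
  (F : set (X -> R))
  (F_meas : forall f, F f -> measurable_fun setT f)
  (F_phi0 : F phi0)
  (F_phi_star : cvg_outer_prob P0 (fun n x =>
     inner_prob (iid_law (Q n) n.+1)
       [set w | F (phi_star n x (boot_sample (gamma n) x w))]) 1)
  (F_boot : forall n x f, F f ->
     (boot_law (Q n) (gamma n) x).-integrable setT (EFin \o f))
  (G_bounded : forall n x w, exists M : R, forall f : F,
     `|Num.sqrt n.+1%:R * boot_diff (Q n) (gamma n) x w (set_val f)| <= M)
  (dO : measure_display) (O : measurableType dO) (PO : probability O R)
  (G0 : O -> linf (R := R) F) (G0_bridge : brownian_bridge P0 PO G0)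
  (G_weak : cond_weak_cvg P0 Q (fun n x w => Linf (G_bounded n x w)) PO G0)
  (phi_star_L2 : oPW P0 Q (fun=> 1) (fun n x w =>
     ('N[P0]_2%:E[(fun z =>
       (phi_star n x (boot_sample (gamma n) x w) z - phi0 z)%:E)])%E))
  (remainder : oPW P0 Q (fun n => (Num.sqrt n.+1%:R)^-1) (fun n x w =>
     let xs := boot_sample (gamma n) x w in
     (T (eta_star n x xs) (empirical xs)
        - T (eta_n n x) (boot_law (Q n) (gamma n) x)
        - boot_diff (Q n) (gamma n) x w (phi_star n x xs))%:E)) :
  oPW P0 Q (fun n => (Num.sqrt n.+1%:R)^-1) (fun n x w =>
     let xs := boot_sample (gamma n) x w in
     (T (eta_star n x xs) (empirical xs)
        - (T (eta_n n x) (boot_law (Q n) (gamma n) x)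
           + boot_diff (Q n) (gamma n) x w phi0))%:E)
  /\
  cond_weak_cvg P0 Q (D := R^o) (fun n x w =>
     let xs := boot_sample (gamma n) x w in
     Num.sqrt n.+1%:R * (T (eta_star n x xs) (empirical xs)
        - T (eta_n n x) (boot_law (Q n) (gamma n) x)))
    PO (fun o => G0 o (exist _ phi0 (mem_set F_phi0))).
Proof.
pose f0 : F := exist _ phi0 (mem_set F_phi0).
pose G n x w := Linf (@G_bounded n x w).
pose rt n : R := Num.sqrt n.+1%:R.
pose Y n (x : n.+1.-tuple X) (w : n.+1.-tuple (W n)) : R :=
  T (eta_star n x (boot_sample (gamma n) x w)) (empirical (boot_sample (gamma n) x w))
  - T (eta_n n x) (boot_law (Q n) (gamma n) x).
have linear : oPW P0 Q (fun n => (rt n)^-1) (fun n x w =>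
    let xs := boot_sample (gamma n) x w in
    (T (eta_star n x xs) (empirical xs)
      - (T (eta_n n x) (boot_law (Q n) (gamma n) x)
         + boot_diff (Q n) (gamma n) x w phi0))%:E).
  apply/oPWP => eps lam eps0 lam0.
  (* An increment of at least [eps / 2] makes the truncated half-oscillation at
     least [tau]; the four exceptional events get probability [lam / 4] each. *)
  pose tau := Num.min 1 (eps / 4).
  have tau0 : 0 < tau by rewrite lt_min ltr01 divr_gt0.
  have e4 : 0 < lam / 4 by rewrite divr_gt0.
  have e2 : 0 < eps / 2 by rewrite divr_gt0.
  have i0 : 0 < tau * (lam / 4) / 2 by rewrite divr_gt0// mulr_gt0.
  have [delta delta0 G0_osc] := bridge_continuous f0 F_meas G0_bridge i0.
  set B := [set f | _] in G0_osc.
  have Bf0 : B f0.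
    rewrite /B/= (_ : (fun z => _) = cst 0%E) ?Lnorm0 ?lte_fin//.
    by apply/funext => z; rewrite subrr.
  have s1 := (oPWP P0 Q _ _).1 remainder _ _ e2 e4.
  have s2 := cond_small_inner_prob e4 F_phi_star.
  have s3 := (oPWP P0 Q _ _).1 phi_star_L2 _ _ delta0 e4.
  have s4 := cond_weak_cvg_small G_weak (BL1_trunc_osc Bf0)
    (fun z => proj1 (andP (trunc_osc_bounds Bf0 z))) tau0 e4 G0_osc.
  rewrite (_ : lam = (lam / 4 + lam / 4) + (lam / 4 + lam / 4)); last by lra.
  apply: cond_smallU (cond_smallU (fun n x => @subset_refl _ _) s1 s2)
    (cond_smallU (fun n x => @subset_refl _ _) s3 s4) => n x w /=.
  set xs := boot_sample _ _ _; rewrite !invrK invr1 mule1 !lee_fin opprD addrA => le_eps.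
  have [|Rlt] := boolP (eps / 2 <= _); first by left; left.
  have [Fp|] := pselect (F (phi_star n x xs)); last by left; right.
  have [|Llt] := boolP (delta%:E <= _)%E; first by right; left.
  right; right.
  pose fs : F := exist _ (phi_star n x xs) (mem_set Fp).
  have Bfs : B fs.
    by move: Llt; rewrite -ltNge gee0_abs ?Lnorm_ge0.
  have := osc_ge f0 (G n x w) Bfs.
  move: Rlt le_eps; rewrite -ltNge /trunc_osc /= -/(rt n).
  set p0 := boot_diff _ _ _ _ phi0; set ps := boot_diff _ _ _ _ _.
  rewrite -/(Y n x w) => Rlt le_eps le_osc.
  have le_o : eps / 2 <= osc B f0 (G n x w).
    apply: le_trans le_osc.
    have -> : rt n * ps - rt n * p0 = (Y n x w - p0) * rt n - (Y n x w - ps) * rt n.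
      by ring.
    by apply: le_trans (lerB_dist _ _); lra.
  by rewrite /tau /Num.min; do 2 case: ifPn; rewrite -?leNgt => *; lra.
split; first exact: linear.
apply: (cond_weak_cvg_slutsky (f := fun z : linf F => z f0 : R^o) G_weak).
  by move=> y z; rewrite {1}/mdist/= distrC linf_dist_ge.
move=> eps lam eps0 lam0.
apply: vanishing_sub ((oPWP P0 Q _ _).1 linear _ _ eps0 lam0) => n x /=.
move=> /le_trans; apply; apply: outer_prob_le => w /=.
rewrite -[set_val f0]/phi0; set p0 := boot_diff _ _ _ _ phi0.
rewrite {1}/mdist/= distrC -mulrBr lee_fin invrK.
by rewrite [- (_ + p0)]opprD [in X in _ -> X]addrA mulrC.
Qed.
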